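(* Let $f, g \colon \mathbb{R}^n \to \mathbb{R}^n$ be polynomial maps. If the restriction of the map $(f, g)$ to the set $$K := \{x \in \mathbb{R}^n : f(x) \ge 0,\ g(x) \ge 0\}$$ is a $P$-function, then $\mathrm{SOL}(f, g)$ has at most one element.
   Context: A pair map $(f, g) \colon K \subset \mathbb{R}^n \to \mathbb{R}^n \times \mathbb{R}^n$ is a $P$-function if for every $x, y \in K$ with $x \ne y$ there exists an index $i\in\{1,\ldots,n\}$ such that $(f_i(x) - f_i(y))(g_i(x) - g_i(y)) > 0$. For polynomial maps $f,g\colon\mathbb{R}^n\to\mathbb{R}^n$, $\mathrm{SOL}(f,g):=\{x\in\mathbb{R}^n : f(x)\ge 0,\ g(x)\ge 0,\ \langle f(x),g(x)\rangle=0\}$, with vector inequalities componentwise. *)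

(* Defs.v *)
From HB Require Import structures.
From mathcomp Require Import all_boot all_order all_algebra.
From mathcomp Require Import classical_sets reals.
From mathcomp Require mpoly.

Set Implicit Arguments.
Unset Strict Implicit.
Unset Printing Implicit Defensive.

Import Order.TTheory GRing.Theory Num.Theory.
Local Open Scope classical_set_scope.
Local Open Scope ring_scope.

(* [mpoly] is required without being imported, because its notations clash with
   those of the classical layer; [mpoly.mpoly n R] is [{mpoly R[n]}] and
   [mpoly.meval v p] is [p.@[v]]. *)

Section Complementarity.
Variables (R : realType) (n : nat).
Implicit Types (f g : 'rV[R]_n -> 'rV[R]_n) (x y : 'rV[R]_n).

Definition polynomial_map f : Prop :=
  exists p : 'I_n -> mpoly.mpoly n R,
    forall x i, f x 0 i = mpoly.meval (fun j => x 0 j) (p i).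

Definition vec_ge0 (v : 'rV[R]_n) : Prop := forall i, 0 <= v 0 i.

Definition dotprod (u v : 'rV[R]_n) : R := \sum_(i < n) u 0 i * v 0 i.

(* The values of [f] and [g] outside [K] are irrelevant: this is the property of
   the restriction of the pair [(f, g)] to [K]. *)
Definition P_function_on (K : set 'rV[R]_n) f g : Prop :=
  forall x y, K x -> K y -> x <> y ->
    exists i : 'I_n, 0 < (f x 0 i - f y 0 i) * (g x 0 i - g y 0 i).

Definition feasible_set f g : set 'rV[R]_n :=
  [set x | vec_ge0 (f x) /\ vec_ge0 (g x)].

Definition SOL f g : set 'rV[R]_n :=
  [set x | [/\ vec_ge0 (f x), vec_ge0 (g x) & dotprod (f x) (g x) = 0]].

End Complementarity.

(* Main.v *)
Require Import Defs.
From HB Require Import structures.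
From mathcomp Require Import all_boot all_order all_algebra.
From mathcomp Require Import classical_sets reals.

(** At a solution the scalar product of the nonnegative vectors [f x] and [g x]
    vanishes, hence so does each product [f_i x * g_i x]. For two solutions
    [x] and [y], expanding the product of differences therefore leaves
    [- (f_i x * g_i y) - f_i y * g_i x], which is nonpositive for every [i];
    this contradicts the P-property unless [x = y]. *)

Set Implicit Arguments.
Unset Strict Implicit.
Unset Printing Implicit Defensive.

Import Order.TTheory GRing.Theory Num.Theory.
Local Open Scope classical_set_scope.
Local Open Scope ring_scope.

Lemma dotprod_eq0_mul (R : realType) (n : nat) (u v : 'rV[R]_n) :
  vec_ge0 u -> vec_ge0 v -> dotprod u v = 0 -> forall i, u 0 i * v 0 i = 0.
Proof.
move=> u0 v0 uv0 i.
exact: (psumr_eq0P (fun j _ => mulr_ge0 (u0 j) (v0 j)) uv0).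
Qed.

Theorem proposition4p8 (R : realType) (n : nat) (f g : 'rV[R]_n -> 'rV[R]_n)
    (f_poly : polynomial_map f) (g_poly : polynomial_map g)
    (fg_P : P_function_on (feasible_set f g) f g) :
  is_subset1 (SOL f g).
Proof.
move=> x y [fx gx fgx] [fy gy fgy].
have [//|/eqP neq_xy] := eqVneq x y.
have [i] := fg_P x y (conj fx gx) (conj fy gy) neq_xy.
rewrite mulrBl !mulrBr (dotprod_eq0_mul fx gx fgx) (dotprod_eq0_mul fy gy fgy).
by rewrite sub0r subr0 -opprD oppr_gt0 ltNge addr_ge0 ?mulr_ge0.
Qed.
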